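(* (a) There exist colored affine semigroups in $\mathbb{R}^3$ with arbitrarily many colors, formed by normal affine semigroups, with an element all of whose solutions are monochromatic although every color has a solution. That is: for every integer $N$ there exist $\ell \ge N$, a colored affine semigroup $\operatorname{Sg}(A_1,\ldots,A_\ell)$ in $\mathbb{Z}^3$ such that each $\operatorname{Sg}(A_i)$ is a normal affine semigroup, and an element $b$ such that $b$ has a monochromatic solution for every color, but $b$ has no colorful solution and no chromatic solution (in fact, every solution for $b$ is monochromatic). (b) There exist colored affine semigroups in $\mathbb{R}^4$ with arbitrarily many colors, formed by normal affine semigroups, with infinitely many elements that have a monochromatic solution for every color but no colorful solution. That is: for every integer $N$ there exist $\ell \ge N$, a colored affine semigroup $\operatorname{Sg}(A_1,\ldots,A_\ell)$ in $\mathbb{Z}^4$ such that each $\operatorname{Sg}(A_i)$ is a normal affine semigroup, and infinitely many elements $b$ such that $b$ has a monochromatic solution for every color and has no colorful solution.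
   Context: For an integer matrix $A \in \mathbb{Z}^{d\times n}$, the affine semigroup generated by $A$ is $\operatorname{Sg}(A) = \{Ax : x \in \mathbb{Z}^n,\ x \ge 0\}$, and $\operatorname{Cone}(A) = \{Ax : x \in \mathbb{R}^n, x \ge 0\}$. The semigroup $\operatorname{Sg}(A)$ is normal if $\operatorname{Sg}(A) = \operatorname{Cone}(A) \cap \Lambda$ for some lattice $\Lambda$. A colored affine semigroup is an affine semigroup $\operatorname{Sg}(A)$ together with an assignment of one of $\ell$ colors to each column of $A$, giving a partition $\mathcal{I}_1,\ldots,\mathcal{I}_\ell$ of the column indices $\{1,\ldots,n\}$ into nonempty color classes; it is denoted $\operatorname{Sg}(A_1,\ldots,A_\ell)$, where $A_i$ is the submatrix of $A$ consisting of the columns of color $i$. The same column vector may appear more than once, with different colors. A solution for $b$ is a vector $x \in \mathbb{Z}^n$, $x \ge 0$, with $Ax = b$. Let $\operatorname{supp}(x) = \{i : x_i \ne 0\}$; $x$ uses color $c$ if $\operatorname{supp}(x) \cap \mathcal{I}_c \neq \emptyset$. The solution $x$ is: monochromatic if $\operatorname{supp}(x) \subseteq \mathcal{I}_i$ for some $i$ (and it is then a monochromatic solution for color $i$); chromatic if $|\operatorname{supp}(x) \cap \mathcal{I}_i| \ge 1$ for all $i$; colorful if $|\operatorname{supp}(x) \cap \mathcal{I}_i| \le 1$ for all $i$. *)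

(* Defs.v *)
From HB Require Import structures.
From mathcomp Require Import all_boot all_order all_algebra.
From mathcomp Require Import classical_sets reals.
Set Implicit Arguments.
Unset Strict Implicit.
Unset Printing Implicit Defensive.
Import Order.TTheory GRing.Theory Num.Theory.
Local Open Scope classical_set_scope.
Local Open Scope ring_scope.

Definition solution (d n : nat) (A : 'M[int]_(d, n)) (b : 'cV[int]_d)
    (x : 'cV[int]_n) : Prop :=
  (forall j, 0 <= x j 0) /\ A *m x = b.

Definition Sg (d n : nat) (A : 'M[int]_(d, n)) : set 'cV[int]_d :=
  [set b | exists x, solution A b x].

Definition Cone (R : realType) (d n : nat) (A : 'M[int]_(d, n)) :
    set 'cV[R]_d :=
  [set map_mx intr A *m x | x in [set x : 'cV[R]_n | forall j, 0 <= x j 0]].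
Arguments Cone R {d n} A.

(* A lattice is the integer span of R-linearly independent vectors (the
   columns of B); it is not required to have full rank. *)
Definition lattice (R : realType) (d : nat) (L : set 'cV[R]_d) : Prop :=
  exists (k : nat) (B : 'M[R]_(d, k)),
    row_free B^T /\ L = [set B *m map_mx intr z | z in [set: 'cV[int]_k]].

Definition normal_Sg (R : realType) (d n : nat) (A : 'M[int]_(d, n)) : Prop :=
  exists L : set 'cV[R]_d,
    lattice L /\ [set map_mx intr b | b in Sg A] = Cone R A `&` L.
Arguments normal_Sg R {d n} A.

Record colored_semigroup (d l : nat) := ColoredSemigroup {
  ngens : nat;
  gens : 'M[int]_(d, ngens);
  color : 'I_ngens -> 'I_l;
  color_surj : forall i : 'I_l, exists j, color j = i }.

Section Colored.
Variables (d l : nat) (S : colored_semigroup d l).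

Definition color_class (i : 'I_l) : {set 'I_(ngens S)} :=
  [set j | color j == i]%SET.

Definition color_gens (i : 'I_l) : 'M[int]_(d, #|color_class i|) :=
  colsub (fun k : 'I_#|color_class i| => enum_val k) (gens S).

Definition supp (x : 'cV[int]_(ngens S)) : {set 'I_(ngens S)} :=
  [set j | x j 0 != 0]%SET.

Definition monochromatic_for (i : 'I_l) (x : 'cV[int]_(ngens S)) : Prop :=
  supp x \subset color_class i.

Definition monochromatic (x : 'cV[int]_(ngens S)) : Prop :=
  exists i, monochromatic_for i x.

Definition chromatic (x : 'cV[int]_(ngens S)) : Prop :=
  forall i, (1 <= #|supp x :&: color_class i|)%N.

Definition colorful (x : 'cV[int]_(ngens S)) : Prop :=
  forall i, (#|supp x :&: color_class i| <= 1)%N.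

Definition has_all_monochromatic (b : 'cV[int]_d) : Prop :=
  forall i, exists x, solution (gens S) b x /\ monochromatic_for i x.

Definition has_colorful (b : 'cV[int]_d) : Prop :=
  exists x, solution (gens S) b x /\ colorful x.

Definition has_chromatic (b : 'cV[int]_d) : Prop :=
  exists x, solution (gens S) b x /\ chromatic x.

End Colored.

(* Main.v *)
Require Import Defs.
From HB Require Import structures.
From mathcomp Require Import all_boot all_order all_algebra.
From mathcomp Require Import classical_sets cardinality reals.
From mathcomp Require Import ring zify.

(** Both parts are witnessed by one family of semigroups, [pairs]. Give color
    [i] the two points [(i+1, 1, 0)] and [(-(i+1), 1, 0)] together with the
    point [(0, 0, 1)], which is repeated in every color, and take as elements
    the vectors [(0, 2, m)], all padded with zeros up to the ambient dimension.

    The second coordinate acts as a height: a solution for [(0, 2, m)] uses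
    exactly two of the points at height 1, counted with multiplicity, and by
    the first coordinate these two are opposite to each other. As the
    absolute values [i+1] differ from color to color, opposite points share
    their color, so every solution uses two generators of one same color and
    none is colorful ([pairs_solution_pair], [pairs_not_colorful]). The number
    of uses of the points [(0, 0, 1)] is the free parameter [m]. For [m = 0]
    they do not occur at all, and every solution is monochromatic, which is
    the first part; letting [m] vary gives infinitely many elements, which is
    the second part.

    Each color is normal because its three generators are linearly
    independent: a semigroup generated by the columns of a matrix with
    independent columns consists of the points of its cone that lie in the
    lattice spanned by these same columns ([normal_Sg_free]). *)

Set Implicit Arguments.
Unset Strict Implicit.
Unset Printing Implicit Defensive.
Import Order.TTheory GRing.Theory Num.Theory.
Local Open Scope classical_set_scope.
Local Open Scope ring_scope.

(** The lattice to intersect with is the one spanned by the generators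
    themselves: since coordinates with respect to them are unique, a lattice
    point of the cone has coordinates that are both integral and nonnegative. *)
Lemma normal_Sg_free (R : realType) (d n : nat) (A : 'M[int]_(d, n)) :
  row_free (map_mx intr A : 'M[R]_(d, n))^T -> normal_Sg R A.
Proof.
set B := map_mx intr A => freeB.
exists [set B *m map_mx intr z | z in [set: 'cV[int]_n]]; split.
  by exists n, B.
apply/seteqP; split => [_ [_ [x [x_ge0 <-]] <-] | _ [[y y_ge0 <-] [z _ Bz]]].
  rewrite map_mxM; split; last by exists x.
  by exists (map_mx intr x) => // j; rewrite mxE ler0z.
have zy : map_mx intr z = y.
  apply: trmx_inj; apply: (row_free_inj freeB).
  by rewrite -!trmx_mul Bz.
exists (A *m z); last by rewrite map_mxM -Bz.
by exists z; split=> // j; have := y_ge0 j; rewrite -zy mxE ler0z.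
Qed.

(** Pairing a linear relation between the columns with the functional [w] that
    isolates column [j] shows that the [j]-th coefficient vanishes. *)
Lemma row_free_dual (R : realType) (d n : nat) (A : 'M[int]_(d, n)) :
  (forall j, exists w : 'rV[int]_d, forall k, ((w *m A) 0 k == 0) = (k != j)) ->
  row_free (map_mx intr A : 'M[R]_(d, n))^T.
Proof.
move=> dual; apply/inj_row_free => v /(congr1 trmx).
rewrite trmx_mul trmxK trmx0 => Av0; apply/rowP => j.
have [w wP] := dual j.
have := congr1 (fun u => (map_mx intr w *m u) 0 0) Av0.
rewrite /= mulmxA -map_mxM mulmx0 mxE (bigD1 j) //= big1 => [|k kj]; last first.
  have /eqP wk0 : (w *m A) 0 k == 0 by rewrite wP.
  by rewrite [map_mx _ _ _ _]mxE wk0 mul0r.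
rewrite addr0 [RHS]mxE => /eqP; rewrite mulf_eq0 !mxE intr_eq0.
by have := wP j; rewrite mxE eqxx => -> /= /eqP.
Qed.

(** Stating the criterion on all the generators, with a functional that only
    has to vanish on the generators of the same color, avoids any reference to
    the enumeration of a color class in applications. *)
Lemma normal_color_gens (R : realType) (d l : nat) (S : colored_semigroup d l)
    (i : 'I_l) :
  (forall j, exists w : 'rV[int]_d, forall k,
     color k = color j -> ((w *m gens S) 0 k == 0) = (k != j)) ->
  normal_Sg R (color_gens S i).
Proof.
move=> dual; apply/normal_Sg_free/row_free_dual => j.
have [w wP] := dual (enum_val j); exists w => k.
have colorE (h : 'I_#|color_class S i|) : color (enum_val h) = i.
  by have := enum_valP h; rewrite inE => /eqP.
rewrite -(inj_eq enum_val_inj) -wP ?colorE //.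
by rewrite /color_gens mulmx_colsub mxE.
Qed.

Lemma sum_int_peel (T : finType) (w : T -> int) (n : nat) :
    (forall t, 0 <= w t) -> \sum_t w t = n.+1%:Z ->
  exists (a : T) (u : T -> int),
    [/\ forall t, 0 <= u t, \sum_t u t = n%:Z & forall t, w t = (t == a)%:R + u t].
Proof.
move=> w_ge0 w_sum.
have [a wa] : exists a, 0 < w a.
  apply/existsP; apply: contraT; rewrite negb_exists => /forallP w_le0.
  suff: \sum_t w t <= 0 by rewrite w_sum.
  by apply: sumr_le0 => t _; rewrite leNgt.
exists a, (fun t => w t - (t == a)%:R); split=> [t||t].
- by case: eqP => [->|_]; rewrite subr_ge0.
- by rewrite sumrB w_sum (bigD1 a) //= eqxx big1 => [|t /negPf->//]; lia.
- by rewrite addrC subrK.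
Qed.

(** A solution of total multiplicity 2 is a multiset of two generators; naming
    them replaces the combinatorics of coefficients by that of two points. *)
Lemma sum_int_eq2 (T : finType) (w : T -> int) :
    (forall t, 0 <= w t) -> \sum_t w t = 2 ->
  exists a b : T, forall t, w t = (t == a)%:R + (t == b)%:R.
Proof.
move=> w_ge0 /(sum_int_peel w_ge0)[a [u [u_ge0 + wE]]].
move=> /(sum_int_peel u_ge0)[b [v [v_ge0 /eqP + uE]]].
rewrite psumr_eq0 // => /allP v0; exists a, b => t.
by rewrite wE uE (eqP (v0 t _)) ?mem_index_enum // addr0.
Qed.

Lemma sum_pair_bool (I : finType) (F : I * bool -> int) :
  \sum_p F p = \sum_i (F (i, true) + F (i, false)).
Proof.
rewrite (eq_bigr (fun p => F (p.1, p.2))) => [|[] //].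
rewrite -(pair_bigA _ (fun i s => F (i, s))) /=.
by apply: eq_bigr => i _; rewrite big_bool.
Qed.

Section PairsOfOppositePoints.
Variables d l : nat.

(** The two points of color [i] at height 1 are indexed by the pairs [(i, s)],
    where [s] is the sign bit: [true] stands for the negative abscissa. *)
Definition abscissa (p : 'I_l * bool) : int := (-1) ^+ p.2 * (p.1.+1)%:Z.

(** These lists are read with the default value 0, so that all coordinates
    from the fourth on are zero. *)
Definition coords (t : 'I_l * bool + 'I_l) : seq int :=
  match t with inl p => [:: abscissa p; 1; 0] | inr _ => [:: 0; 0; 1] end.

Definition index_color (t : 'I_l * bool + 'I_l) : 'I_l :=
  match t with inl p => p.1 | inr i => i end.

Definition pairs_gens : 'M[int]_(d.+3, #|{: 'I_l * bool + 'I_l}|) :=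
  \matrix_(k, j) (coords (enum_val j))`_k.

Lemma pairs_color_surj (i : 'I_l) :
  exists j : 'I_#|{: 'I_l * bool + 'I_l}|, index_color (enum_val j) = i.
Proof. by exists (enum_rank (inr i)); rewrite enum_rankK. Qed.

Definition pairs : colored_semigroup d.+3 l :=
  @ColoredSemigroup d.+3 l _ pairs_gens _ pairs_color_surj.

Definition target (m : nat) : 'cV[int]_d.+3 := \col_k [:: 0; 2; m%:Z]`_k.

Lemma abscissa_opp_inj (p q : 'I_l * bool) :
  abscissa p + abscissa q = 0 -> p.1 = q.1 /\ p.2 = ~~ q.2.
Proof.
case: p q => [i []] [j []]; rewrite /abscissa /= => e;
  rewrite ?expr0 ?expr1 in e; split=> //; try apply: val_inj => /=; lia.
Qed.

Lemma pairs_solutionP (m : nat) (x : 'cV[int]_(ngens pairs)) :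
  let X t := x (enum_rank t) 0 in
  solution (gens pairs) (target m) x <->
  [/\ forall t, 0 <= X t,
      \sum_p abscissa p * X (inl p) = 0,
      \sum_p X (inl p) = 2 & \sum_i X (inr i) = m%:Z].
Proof.
move=> X.
have rowE (k : 'I_d.+3) : (gens pairs *m x) k 0 =
    \sum_p (coords (inl p))`_k * X (inl p) + \sum_i (coords (inr i))`_k * X (inr i).
  rewrite mxE (reindex _ (onW_bij _ (@enum_rank_bij _))) big_sumType /=.
  by congr (_ + _); apply: eq_bigr => t _; rewrite mxE enum_rankK.
have zero_sum (I : finType) (F : I -> int) : \sum_i 0 * F i = 0.
  by rewrite big1 // => i _; rewrite mul0r.
have one_sum (I : finType) (F : I -> int) : \sum_i 1 * F i = \sum_i F i.
  by apply: eq_bigr => i _; rewrite mul1r.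
split=> [[x_ge0 Ax] | [X_ge0 X0 X1 X2]].
  have coordE k : (gens pairs *m x) k 0 = target m k 0 by rewrite Ax.
  split=> [t|||]; first exact: x_ge0.
  - by have := coordE 0; rewrite rowE mxE /= zero_sum addr0.
  - by have := coordE (inord 1); rewrite rowE mxE inordK //= zero_sum one_sum addr0.
  - by have := coordE (inord 2); rewrite rowE mxE inordK //= zero_sum one_sum add0r.
split=> [j|]; first by rewrite -[j]enum_valK; exact: X_ge0.
apply/colP => -[[|[|[|k]]] klt]; rewrite rowE mxE /=.
- by rewrite X0 zero_sum.
- by rewrite one_sum X1 zero_sum.
- by rewrite one_sum X2 zero_sum.
- by rewrite !nth_nil !zero_sum.
Qed.

(** The points at height 1 have total multiplicity 2, so they are two points
    [a] and [b], whose abscissas must cancel: [b] is then the mirror image of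
    [a], and both have the same color. *)
Lemma pairs_solution_pair (m : nat) (x : 'cV[int]_(ngens pairs)) :
  solution (gens pairs) (target m) x ->
  exists i : 'I_l, forall p, x (enum_rank (inl p)) 0 = (p.1 == i)%:R.
Proof.
move=> /pairs_solutionP[X_ge0 X0 X1 _].
have [a [b XE]] := sum_int_eq2 (fun p => X_ge0 (inl p)) X1.
have pick c : \sum_p abscissa p * (p == c)%:R = abscissa c.
  by rewrite (bigD1 c) //= eqxx mulr1 big1 ?addr0 // => p /negPf->; rewrite mulr0.
have ab0 : abscissa a + abscissa b = 0.
  rewrite -(pick a) -(pick b) -big_split -[RHS]X0.
  by apply: eq_bigr => p _; rewrite XE mulrDr.
have [ab1 ab2] := abscissa_opp_inj ab0.
exists b.1 => p; rewrite XE.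
case: p a b ab1 ab2 {XE ab0} => [i s] [j s'] [k s''] /= -> ->.
by rewrite !xpair_eqE; case: (i == k); case: s; case: s''.
Qed.

Lemma pairs_all_monochromatic (m : nat) : has_all_monochromatic pairs (target m).
Proof.
move=> i; pose w (t : 'I_l * bool + 'I_l) : int :=
  match t with inl p => (p.1 == i)%:R | inr j => m%:Z * (j == i)%:R end.
exists (\col_j w (enum_val j)); split.
  apply/pairs_solutionP.
  have pick (c : int) : \sum_(j < l) c * (j == i)%:R = c.
    by rewrite (bigD1 i) //= eqxx mulr1 big1 ?addr0 // => j /negPf->; rewrite mulr0.
  split=> [[p|j]|||]; rewrite ?mxE ?enum_rankK /=.
  - by case: eqP.
  - by case: eqP; rewrite ?mulr1 ?mulr0.
  - rewrite sum_pair_bool big1 // => j _; rewrite !mxE !enum_rankK /abscissa /=.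
    by rewrite expr0 expr1; ring.
  - rewrite sum_pair_bool.
    under eq_bigr do rewrite !mxE !enum_rankK /= -mulr2n -(mulr_natl _ 2).
    by rewrite pick.
  - under eq_bigr do rewrite mxE enum_rankK /=.
    by rewrite pick.
apply/fintype.subsetP => j; rewrite !inE mxE /=.
by rewrite /w; case: (enum_val j) => [p|k]; case: (_ =P i) => /= _; rewrite ?mulr0 ?eqxx.
Qed.

Lemma pairs_not_colorful (m : nat) : ~ has_colorful pairs (target m).
Proof.
move=> [x [/pairs_solution_pair[i xE] /(_ i)]].
apply/negP; rewrite -ltnNge; apply/card_gt1P.
exists (enum_rank (inl (i, true))), (enum_rank (inl (i, false))).
split; last by apply/eqP => /enum_rank_inj[].
- by rewrite !inE xE /= enum_rankK /= eqxx.
- by rewrite !inE xE /= enum_rankK /= eqxx.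
Qed.

Lemma pairs_solution_monochromatic (x : 'cV[int]_(ngens pairs)) :
  solution (gens pairs) (target 0) x -> monochromatic x.
Proof.
move=> sol_x; have [i xE] := pairs_solution_pair sol_x.
have /pairs_solutionP[X_ge0 _ _ /eqP] := sol_x.
rewrite psumr_eq0 => [/allP X0 | j _]; last exact: X_ge0.
exists i; apply/fintype.subsetP => j; rewrite !inE /= -{1}[j]enum_valK.
case: (enum_val j) => [p|k] /=; first by rewrite xE; case: (_ =P i).
by rewrite (eqP (X0 k _)) ?mem_index_enum.
Qed.

(** The dual functionals: at the point of color [i] and sign [s] the functional
    [(+-1, i+1, 0)], with the same sign, vanishes at the opposite point and at
    [(0, 0, 1)], and takes the value [2(i+1)] at the point itself. *)
Lemma pairs_normal (R : realType) (i : 'I_l) : normal_Sg R (color_gens pairs i).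
Proof.
apply: normal_color_gens => j.
pose W : seq int := match enum_val j with
  | inl p => [:: (-1) ^+ p.2; p.1.+1%:Z; 0] | inr _ => [:: 0; 0; 1] end.
exists (\row_k W`_k) => k /=.
have -> : (\row_h W`_h *m pairs_gens) 0 k =
    W`_0 * (coords (enum_val k))`_0 + W`_1 * (coords (enum_val k))`_1
    + W`_2 * (coords (enum_val k))`_2.
  rewrite mxE 3!big_ord_recl big1 => [|h _]; first by rewrite !mxE addr0 !addrA.
  by rewrite !mxE /W; case: (enum_val j) => [p|?]; rewrite /= nth_nil mul0r.
rewrite -(inj_eq enum_val_inj) {}/W.
case: (enum_val j) (enum_val k) => [[i1 s1]|i1] [[i2 s2]|i2] /= e.
- rewrite (inj_eq (@inl_inj _ _)) xpair_eqE e eqxx /abscissa /=.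
  by case: s1; case: s2; rewrite ?expr0 ?expr1; lia.
- by rewrite !(mulr0, mul0r, addr0).
- by rewrite !(mulr0, mul0r, addr0).
- by rewrite (inj_eq (@inr_inj _ _)) e eqxx.
Qed.

Lemma target_Sg (m : nat) : (0 < l)%N -> Sg (gens pairs) (target m).
Proof.
move=> l_gt0; have [x [sol_x _]] := pairs_all_monochromatic m (Ordinal l_gt0).
by exists x.
Qed.

Lemma target_inj : injective target.
Proof.
move=> m n /(congr1 (fun b : 'cV[int]_d.+3 => b (inord 2) 0)).
by rewrite !mxE inordK //= => -[].
Qed.

End PairsOfOppositePoints.

Lemma monochromatic_not_chromatic (d l : nat) (S : colored_semigroup d l)
    (x : 'cV[int]_(ngens S)) :
  (1 < l)%N -> monochromatic x -> ~ chromatic x.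
Proof.
move=> l_gt1 [i /fintype.subsetP mono_i] chrom_x.
have x_color j : j = i.
  have /card_gt0P[t] := chrom_x j; rewrite inE => /andP[/mono_i].
  by rewrite !inE => /eqP-> /eqP.
have := x_color (Ordinal l_gt1); rewrite -(x_color (Ordinal (ltnW l_gt1))).
by move=> /(congr1 val).
Qed.

Theorem theorem1p4 (R : realType) :
  (forall N : int, exists (l : nat) (S : colored_semigroup 3 l),
     [/\ N <= l%:Z,
         forall i : 'I_l, normal_Sg R (color_gens S i) &
         exists b : 'cV[int]_3,
           [/\ Sg (gens S) b, has_all_monochromatic S b,
               ~ has_colorful S b, ~ has_chromatic S b &
               forall x, solution (gens S) b x -> monochromatic x]])
  /\
  (forall N : int, exists (l : nat) (S : colored_semigroup 4 l),
     [/\ N <= l%:Z,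
         forall i : 'I_l, normal_Sg R (color_gens S i) &
         infinite_set [set b : 'cV[int]_4 |
           [/\ Sg (gens S) b, has_all_monochromatic S b &
               ~ has_colorful S b]]]).
Proof.
split=> N; exists `|N|%N.+2.
  exists (pairs 0 _); split; [by lia | exact: pairs_normal |].
  exists (target 0 0); split.
  - exact: target_Sg.
  - exact: pairs_all_monochromatic.
  - exact: pairs_not_colorful.
  - move=> [x [/pairs_solution_monochromatic mono_x]].
    exact: monochromatic_not_chromatic.
  - exact: pairs_solution_monochromatic.
exists (pairs 1 _); split; [by lia | exact: pairs_normal |].
(* The injection [target] of the natural numbers would pull a finite set of
   elements back to a finite set containing all natural numbers. *)
move=> /(finite_preimage (in2W (@target_inj 1))) fin.
apply: infinite_nat; apply: sub_finite_set fin => m _ /=; split.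
- exact: target_Sg.
- exact: pairs_all_monochromatic.
- exact: pairs_not_colorful.
Qed.
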